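(* Let $m,n,\ell\ge 0$ be integers such that $n+\ell\ge m$. Let $\mathcal R^{\ge 1-\ell}_{m,n}$ be the set of partitions $\lambda$ with at most $m$ parts and largest part at most $n$, all of whose successive ranks are at least $1-\ell$. Then \[ \sum_{\lambda\in \mathcal R_{m,n}^{\ge 1-\ell}} t^{\mathrm{dr}(\lambda)}q^{|\lambda|}= \sum_{i\ge0}t^i q^{i(i+1)}\left(\begin{bmatrix}n-1\\ i\end{bmatrix}_q\begin{bmatrix}m+1\\ i+1\end{bmatrix}_q-q^{\ell+1}\begin{bmatrix}n+\ell\\ i\end{bmatrix}_q\begin{bmatrix}m-\ell\\ i+1\end{bmatrix}_q\right). \]
   Context: A partition $\lambda=(\lambda_1\ge\lambda_2\ge\dots\ge\lambda_k)$ is a weakly decreasing (possibly empty) sequence of positive integers; $|\lambda|=\sum_i\lambda_i$; $k$ is its number of parts; $\lambda_i=0$ for $i>k$. The conjugate $\lambda'$ has parts $\lambda'_j=|\{i:\lambda_i\ge j\}|$. Let $d(\lambda)=\max\{i\ge1:\lambda_i\ge i\}$ ($0$ if $\lambda$ is empty). The height of the Durfee rectangle is $\mathrm{dr}(\lambda)=\max\{i\ge1:\lambda_i\ge i+1\}$, taken to be $0$ if there is no such $i$ (in particular for the empty partition). For $1\le i\le d(\lambda)$, the $i$th successive rank is $r_i(\lambda)=\lambda_i-\lambda'_i$. The empty partition has no ranks, so it satisfies every condition of the form ''all ranks are at least $b$''. Notation: $(q)_n=\prod_{i=1}^n(1-q^i)$, and $\begin{bmatrix}n\\k\end{bmatrix}_q=\frac{(q)_n}{(q)_k(q)_{n-k}}$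 if $0\le k\le n$, and $\begin{bmatrix}n\\k\end{bmatrix}_q=0$ otherwise. Here $q,t$ are formal variables.
   Formalization: The formal theorem assumes n ≥ 1: for n = 0 the identity fails for every admissible m and ℓ, since the left side is 1 (empty partition) while the right side is 0 (the q-binomials with top −1 and m−ℓ ≤ 0 all vanish). *)

(* Defs.v *)
From HB Require Import structures.
From mathcomp Require Import all_boot all_order all_algebra.

Set Implicit Arguments.
Unset Strict Implicit.
Unset Printing Implicit Defensive.

Import Order.TTheory GRing.Theory Num.Theory.

Local Open Scope nat_scope.

Definition is_partition (la : seq nat) : bool :=
  sorted geq la && all (fun x => 0 < x) la.

(* Parts are indexed from 1, and [part la i = 0] for [i > size la]. *)
Definition part (la : seq nat) (i : nat) : nat := nth 0 la i.-1.

Definition conj_part (la : seq nat) (j : nat) : nat :=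
  count (fun x => j <= x) la.

(* In [durfee] and [dr] the index need only run up to [size la], since later
   parts are 0; a maximum over an empty range is 0. *)
Definition durfee (la : seq nat) : nat :=
  \max_(1 <= i < (size la).+1 | i <= part la i) i.

Definition dr (la : seq nat) : nat :=
  \max_(1 <= i < (size la).+1 | i.+1 <= part la i) i.

Definition rank (la : seq nat) (i : nat) : int :=
  ((part la i)%:Z - (conj_part la i)%:Z)%R.

Definition ranks_ge (b : int) (la : seq nat) : bool :=
  all (fun i => (b <= rank la i)%R) (iota 1 (durfee la)).

Definition in_R (m n : nat) (b : int) (la : seq nat) : bool :=
  [&& is_partition la, size la <= m, all (fun x => x <= n) la & ranks_ge b la].

(* Every sequence of at most [m] numbers that are at most [n] is
   [bseq_nat s] for exactly one [s : {bseq m of 'I_n.+1}]; this finite type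
   serves to index sums over [in_R m n b]. *)
Definition bseq_nat (m n : nat) (s : {bseq m of 'I_n.+1}) : seq nat :=
  [seq nat_of_ord x | x <- s].

Local Open Scope ring_scope.

Definition qpoch (K : fieldType) (q : K) (n : nat) : K :=
  \prod_(1 <= i < n.+1) (1 - q ^+ i).

(* The arguments are integers because [m - l] below may be negative; the
   absolute values are taken only of nonnegative integers. *)
Definition qbinom (K : fieldType) (q : K) (n k : int) : K :=
  if (0 <= k) && (k <= n) then
    qpoch q `|n|%N / (qpoch q `|k|%N * qpoch q `|n - k|%N)
  else 0.

(* The field Q(q, t), as the fraction field of Z[q][t]. *)
Definition Qqt : fieldType := {fraction {poly {poly int}}}.
Definition qvar : Qqt := tofrac (('X : {poly int})%:P).
Definition tvar : Qqt := tofrac ('X : {poly {poly int}}).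

(* Main.v *)
(* Let G(m, n) be the left-hand side and call a partition in the m x n box
   extremal if it has exactly m parts and largest part n.  Deleting its outer
   hook (the first row and first column) turns an extremal partition into an
   arbitrary partition of the (m-1) x (n-1) box, removes the first rank n - m
   and shifts the remaining ranks.  Inclusion-exclusion over the two subboxes
   therefore gives
     G(m,n) - G(m-1,n) - G(m,n-1) + G(m-1,n-1)
       = [m < n + l] t^[n > 1] q^(m+n-1) G(m-1,n-1),
   which together with G(0,n) = G(m,0) = 1 determines G, and in particular
   makes G(m,n) constant in m for m >= n + l - 1.  By the q-Pascal rule both
   halves of the right-hand side satisfy the recurrence without the bracket,
   and they cancel appropriately on the line m = n + l. *)
Require Import Defs.
From HB Require Import structures.
From mathcomp Require Import all_boot all_order all_algebra.
From mathcomp Require Import zify ring.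

Set Implicit Arguments.
Unset Strict Implicit.
Unset Printing Implicit Defensive.

Import Order.TTheory GRing.Theory Num.Theory.
Local Open Scope ring_scope.

(** * Gaussian binomials and the recurrences of the right-hand side *)

Section QBinomial.

Variables (K : fieldType) (q t : K).
Hypothesis q_neq1 : forall i, (0 < i)%N -> 1 - q ^+ i != 0.

Lemma qpoch_neq0 n : qpoch q n != 0.
Proof.
rewrite /qpoch big_nat prodf_seq_neq0.
by apply/allP => i _; apply/implyP => /andP[/q_neq1].
Qed.

Lemma qpochS n : qpoch q n.+1 = qpoch q n * (1 - q ^+ n.+1).
Proof. by rewrite /qpoch big_nat_recr. Qed.

Lemma qbinom_nat (n k : nat) : (k <= n)%N ->
  qbinom q n k = qpoch q n / (qpoch q k * qpoch q (n - k)).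
Proof. by move=> le_kn; rewrite /qbinom lez_nat le_kn subzn. Qed.

Lemma qbinom_small (n k : nat) : (n < k)%N -> qbinom q n k = 0.
Proof. by move=> lt_nk; rewrite /qbinom lez_nat leqNgt lt_nk. Qed.

Lemma qbinom0 (n : nat) : qbinom q n 0%N = 1.
Proof.
by rewrite qbinom_nat // subn0 {2}/qpoch big_geq // mul1r divff ?qpoch_neq0.
Qed.

Lemma qbinomnn (n : nat) : qbinom q n n = 1.
Proof.
by rewrite qbinom_nat // subnn {3}/qpoch big_geq // mulr1 divff ?qpoch_neq0.
Qed.

Lemma qbinom_pascal (n k : nat) :
  qbinom q n.+1 k.+1 = qbinom q n k.+1 + q ^+ (n - k) * qbinom q n k.
Proof.
case: (ltngtP n k) => [lt_nk|lt_kn|->].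
- by rewrite !qbinom_small ?mulr0 ?addr0 // ltnW.
- rewrite !qbinom_nat // 1?ltnW // subSS.
  have -> : (n - k = (n - k.+1).+1)%N by rewrite -subSn.
  set j := (n - k.+1)%N; rewrite !qpochS.
  (* With x = q^(k+1) and y = q^(j+1) the claim reduces to 1 - xy = (1 - y) + y(1 - x). *)
  have -> : n.+1 = (k.+1 + j.+1)%N by rewrite /j; lia.
  have := qpoch_neq0 k; have := qpoch_neq0 j.
  have := q_neq1 (ltn0Sn k); have := q_neq1 (ltn0Sn j); rewrite exprD.
  move: (q ^+ k.+1) (q ^+ j.+1) (qpoch q n) (qpoch q k) (qpoch q j).
  move=> x y P Pk Pj y_neq1 x_neq1 Pj_neq0 Pk_neq0.
  by field; rewrite y_neq1 Pj_neq0 Pk_neq0.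
- by rewrite subnn mul1r [qbinom q k k.+1]qbinom_small // add0r !qbinomnn.
Qed.

(* For p = m + 1 and r = n - 1 this is the generating function of all
   partitions in the m x n box; the i-th term collects those whose Durfee
   rectangle is i x (i + 1). *)
Definition durfee_sum (N p r : nat) : K :=
  \sum_(0 <= i < N) t ^+ i * q ^+ (i * i.+1) *
    (qbinom q r i * qbinom q p i.+1).

Lemma durfee_sum_p0 N r : durfee_sum N 0 r = 0.
Proof.
rewrite /durfee_sum big1 // => i _.
by rewrite (qbinom_small (ltn0Sn i)) !mulr0.
Qed.

Lemma durfee_sumS N p r : (p <= N)%N -> durfee_sum N.+1 p r = durfee_sum N p r.
Proof.
move=> le_pN; rewrite /durfee_sum big_nat_recr //=.
by rewrite [qbinom q p _]qbinom_small ?mulr0 ?mulr0 ?addr0 // ltnS.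
Qed.

(** The mixed difference in [p] and [r] of a function of [p] times a function of [r] is the product
    of their differences, which Pascal's rule evaluates: the terms of index [i.+1] yield the term of
    index [i] of the last sum. The terms of index 0 do not depend on [r] and cancel. *)
Lemma durfee_sum_rec N p r :
  durfee_sum N.+1 p.+1 r.+1 =
  durfee_sum N.+1 p r.+1 + durfee_sum N.+1 p.+1 r - durfee_sum N.+1 p r
    + t * q ^+ (p + r).+1 * durfee_sum N p r.
Proof.
rewrite /durfee_sum !(big_nat_recl N) //= !qbinom0.
apply/eqP; rewrite -subr_eq0; apply/eqP.
rewrite mulr_sumr.
set a := bigop _ _ _; set b := bigop _ _ _; set c := bigop _ _ _.
set d := bigop _ _ _; set e := bigop _ _ _.
suff -> : a = b + c - d + e by ring.
rewrite /a /b /c /d /e -big_split -sumrB -big_split; apply: eq_bigr => i _ /=.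
rewrite !qbinom_pascal.
(* [r - i] and [p - i.+1] are truncated; where they would be negative, vanishing binomials settle
   the claim. *)
have [lt_ri|le_ir] := ltnP r i.
  rewrite [qbinom q r i]qbinom_small // [qbinom q r i.+1]qbinom_small ?leqW //.
  by ring.
have [lt_pi|le_ip] := ltnP p i.+1.
  by rewrite [qbinom q p i.+1]qbinom_small //; ring.
have e1 : ((p + r).+1 + i * i.+1 = i.+1 * i.+2 + (r - i) + (p - i.+1))%N by lia.
transitivity (t ^+ i.+1 * q ^+ (i.+1 * i.+2) *
      (qbinom q r i.+1 * qbinom q p i.+2
       + q ^+ (r - i) * qbinom q r i * qbinom q p i.+2
       + qbinom q r i.+1 * (q ^+ (p - i.+1) * qbinom q p i.+1))
    + t ^+ i.+1 * q ^+ ((p + r).+1 + i * i.+1) * qbinom q r i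
      * qbinom q p i.+1).
  by rewrite e1 !exprD; ring.
by rewrite exprD exprS; ring.
Qed.

(* The increments in m of the two halves of the right-hand side agree on the
   line m = n + l. *)
Lemma durfee_sum_diag N r l :
  durfee_sum N (r + l).+2 r - durfee_sum N (r + l).+1 r =
  q ^+ l.+1 * (durfee_sum N r.+1 (r + l).+1 - durfee_sum N r (r + l).+1).
Proof.
rewrite /durfee_sum -!sumrB mulr_sumr; apply: eq_bigr => i _.
rewrite !(qbinom_pascal _ i).
have [lt_ri|le_ir] := ltnP r i.
  by rewrite [qbinom q r i]qbinom_small //; ring.
by rewrite (_ : ((r + l).+1 - i = l.+1 + (r - i))%N) ?exprD; [ring|lia].
Qed.

Lemma durfee_sum_r0 N p : durfee_sum N.+1 p.+1 0 = durfee_sum N.+1 p 0 + q ^+ p.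
Proof.
rewrite /durfee_sum !big_nat_recl //= !big1 => [|i _|i _]; last 2 first.
- by rewrite [qbinom q 0 _]qbinom_small // mul0r mulr0.
- by rewrite [qbinom q 0 _]qbinom_small // mul0r mulr0.
by rewrite qbinom_pascal !qbinom0 subn0; ring.
Qed.

Lemma durfee_sum_p1 N r : durfee_sum N.+1 1 r = 1.
Proof.
rewrite /durfee_sum big_nat_recl //= big1 => [|i _]; last first.
  by rewrite [qbinom q 1 _]qbinom_small ?mulr0 ?mulr0.
by rewrite qbinom0 qbinomnn; ring.
Qed.

(** Induction on [n], then on [m], that never leaves the region [m <= n.+1 + l]. The last step in
    [m] has no bracket; there both sides are constant in [m], the right one by [durfee_sum_diag]. *)
Lemma corner_recurrence_solution (l : nat) (G : nat -> nat -> K) :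
    (forall n, G 0 n = 1) -> (forall m, G m 0 = 1) ->
    (forall m n, G m.+1 n.+1 = G m n.+1 + G m.+1 n - G m n +
       (if (m < n + l)%N then t ^+ (0 < n) * q ^+ (m + n).+1 * G m n else 0)) ->
  forall n m N, (m <= n.+1 + l)%N -> (m < N)%N ->
  G m n.+1 = durfee_sum N m.+1 n - q ^+ l.+1 * durfee_sum N (m - l) (n.+1 + l).
Proof.
move=> G0n Gm0 Grec.
(* Without the bracket the increment in [m] is the same for [n.+1] and [n], and it is 0 for
   [n = 0]. *)
have Gstable m n : (n + l <= m.+1)%N -> G m.+1 n = G m n.
  elim: n => [|n IHn] le_nl_m; first by rewrite !Gm0.
  rewrite Grec IHn 1?ltnNge; last by rewrite addSn in le_nl_m; apply: ltnW.
  by rewrite -ltnS -addSn le_nl_m /= addr0 addrK.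
elim=> [|n IHn]; elim=> [|m IHm] [|N] // le_m lt_mN.
- by rewrite G0n durfee_sum_p1 sub0n durfee_sum_p0 mulr0 subr0.
- have [lt_m|ge_m] := ltnP m l; last first.
    have {le_m ge_m} def_m : m = l by lia.
    subst m.
    rewrite Gstable // (IHm N.+1) //; [|lia..].
    have := durfee_sum_diag N.+1 0 l; rewrite !add0n !add1n subSn // subnn.
    rewrite !durfee_sum_p0 ?subr0 ?mulr0 ?subr0.
    by move/eqP; rewrite subr_eq => /eqP ->; ring.
  (* For one column the bracket carries no [t]; its [q ^+ m.+1] is the increment given by
     [durfee_sum_r0]. *)
  rewrite Grec add0n lt_m !Gm0 (IHm N.+1); [|lia..].
  have /eqP -> : (m - l == 0)%N by lia.
  have /eqP -> : (m.+1 - l == 0)%N by lia.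
  by rewrite !durfee_sum_p0 (durfee_sum_r0 N m.+1) addn0 /=; ring.
- by rewrite G0n durfee_sum_p1 sub0n durfee_sum_p0 mulr0 subr0.
have [lt_m|ge_m] := ltnP m (n.+1 + l); last first.
  have {le_m} def_m : m = (n.+1 + l)%N by lia.
  rewrite Gstable; last by lia.
  rewrite (IHm N.+1); [|lia..].
  have := durfee_sum_diag N.+1 n.+1 l.
  rewrite -def_m subSn ?[(n.+2 + _)%N]addSn -?def_m; last by lia.
  have -> : (m - l = n.+1)%N by lia.
  by move/eqP; rewrite subr_eq => /eqP ->; ring.
rewrite Grec lt_m (IHm N.+1) ?(IHn m.+1 N.+1) ?(IHn m N.+1); [|lia..].
rewrite (durfee_sum_rec N m.+1 n) (@durfee_sumS N m.+1 n); last lia.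
have [lt_ml|le_lm] := ltnP m l.
  have /eqP -> : (m - l == 0)%N by lia.
  have /eqP -> : (m.+1 - l == 0)%N by lia.
  by rewrite !durfee_sum_p0 /= ?addnS ?addSn; ring.
rewrite subSn // [(n.+2 + l)%N]addSn (durfee_sum_rec N (m - l) (n.+1 + l)).
rewrite (@durfee_sumS N (m - l) (n.+1 + l)); last lia.
(* [p + r] is the same for both halves, so both gain the factor [t * q ^+ (m + n).+2]. *)
have -> : (m - l + (n.+1 + l) = m.+1 + n)%N by lia.
by rewrite (addSnnS m n) /=; ring.
Qed.

End QBinomial.

(** * Adding and removing the outer hook *)

Local Open Scope nat_scope.

Lemma geq_trans : transitive geq.
Proof. by move=> y x z /= le_yx /leq_trans; apply. Qed.

(** The default 0 of [nth] pads [mu] to [m] rows, so rows beyond [mu] become parts equal to 1. *)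
Definition add_hook (m n : nat) (mu : seq nat) : seq nat :=
  n.+1 :: mkseq (fun i => (nth 0 mu i).+1) m.

(** Parts equal to 1 lie wholly in the first column and disappear with the hook. *)
Definition remove_hook (la : seq nat) : seq nat :=
  [seq x.-1 | x <- behead la & 1 < x].

Lemma mkseq_nth_cat (m : nat) (mu : seq nat) : size mu <= m ->
  mkseq (fun i => (nth 0 mu i).+1) m = map S mu ++ nseq (m - size mu) 1.
Proof.
move=> le_m; apply: (@eq_from_nth _ 0) => [|i].
  by rewrite size_cat size_map size_nseq size_mkseq subnKC.
rewrite size_mkseq => lt_im; rewrite nth_mkseq // nth_cat size_map nth_nseq.
case: ltnP => [lt_i|le_i]; first by rewrite (nth_map 0).
by rewrite nth_default // ltn_sub2r // (leq_ltn_trans le_i).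
Qed.

Lemma max_succ (I : Type) (r : seq I) (P : pred I) (F : I -> nat) :
  (\max_(i <- r | P i) F i).+1 = maxn 1 (\max_(i <- r | P i) (F i).+1).
Proof.
elim: r => [|i r IHr]; first by rewrite !big_nil.
by rewrite !big_cons; case: ifP => // _; rewrite maxnCA -IHr maxnSS.
Qed.

(* [k = 0] gives [durfee] and [k = 1] gives [dr]. *)
Lemma max_part_add_hook k m n mu : k <= n -> size mu <= m ->
  \max_(1 <= i < (size (add_hook m n mu)).+1
        | i + k <= part (add_hook m n mu) i) i
  = (\max_(1 <= i < (size mu).+1 | i + k <= part mu i) i).+1.
Proof.
move=> le_kn le_m; rewrite /= size_mkseq big_ltn_cond // /part /= add1n ltnS le_kn.
rewrite (max_succ _ _ id); congr (maxn 1 _).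
rewrite big_add1 /= [RHS](big_nat_widen _ _ m.+1) //.
rewrite big_nat_cond [RHS]big_nat_cond.
apply: eq_bigl => -[//|i]; rewrite !ltnS /= addSn.
case: (ltnP i m) => [lt_im|le_mi]; last by [].
rewrite nth_mkseq //= ltnS; case: ltnP => [_|le_i]; first by rewrite andbT.
by rewrite nth_default // addSn ltn0.
Qed.

Lemma durfee_add_hook m n mu : size mu <= m ->
  durfee (add_hook m n mu) = (durfee mu).+1.
Proof.
move=> le_m; have := max_part_add_hook (leq0n n) le_m; rewrite /durfee.
by under eq_bigl do rewrite addn0; under [in RHS]eq_bigl do rewrite addn0.
Qed.

(** For [n = 0] all parts are at most 1 and [dr] stays 0; otherwise the new first row has length at
    least 2 and the Durfee rectangle gains a row. *)
Lemma dr_add_hook m n mu : size mu <= m -> all (fun x => x <= n) mu ->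
  dr (add_hook m n mu) = (0 < n) + dr mu.
Proof.
move=> le_m mu_le; case: n mu_le => [|n] mu_le; last first.
  have := max_part_add_hook (ltn0Sn n) le_m; rewrite /dr.
  by under eq_bigl do rewrite addn1; under [in RHS]eq_bigl do rewrite addn1.
have dr0 la : (forall j, part la j <= 1) -> dr la = 0.
  move=> la_le1; rewrite /dr big_nat_cond big_pred0 // => -[|i] //=.
  by rewrite [_ <= part _ _]leqNgt (leq_ltn_trans (la_le1 _)) ?andbF.
have nth_mu j : nth 0 mu j = 0.
  case: (ltnP j (size mu)) => [lt_j|?]; last by rewrite nth_default.
  by apply/eqP; rewrite -leqn0; apply: (allP mu_le); rewrite mem_nth.
rewrite !dr0 // => j; rewrite /part ?nth_mu //.
case: j.-1 => [|i] //=; case: (ltnP i m) => [lt_im|le_mi].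
  by rewrite nth_mkseq // nth_mu.
by rewrite nth_default ?size_mkseq.
Qed.

Lemma sumn_add_hook m n mu : size mu <= m ->
  sumn (add_hook m n mu) = (m + n).+1 + sumn mu.
Proof.
move=> le_m; rewrite /= mkseq_nth_cat // sumn_cat sumn_nseq mul1n.
suff -> : sumn (map S mu) = size mu + sumn mu by lia.
by elim: mu {le_m} => //= x mu ->; lia.
Qed.

Lemma conj_part_add_hook m n mu j : 0 < j <= n -> size mu <= m ->
  conj_part (add_hook m n mu) j.+1 = (conj_part mu j).+1.
Proof.
case/andP=> j_gt0 le_jn le_m; rewrite /conj_part /= mkseq_nth_cat // ltnS le_jn.
rewrite count_cat count_map count_nseq ltnS leqn0 eqn0Ngt j_gt0 /= mul0n addn0.
by rewrite add1n; congr _.+1; apply: eq_count => x /=.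
Qed.

Lemma conj_part_add_hook1 m n mu : conj_part (add_hook m n mu) 1 = m.+1.
Proof.
rewrite /conj_part /= add1n -[in RHS](size_mkseq (fun i => (nth 0 mu i).+1) m).
by congr _.+1; apply/eqP; rewrite -all_count; apply/allP => x /mapP[i _ ->].
Qed.

(** The maximum is attained at some [i >= j], and since parts decrease,
    [part mu j >= part mu i >= i >= j]. *)
Lemma leq_durfee mu j : sorted geq mu -> 0 < j <= durfee mu -> j <= part mu j.
Proof.
move=> mu_sorted /andP[j_gt0 le_j].
rewrite leqNgt; apply: contraL le_j => lt_j; rewrite -ltnNge.
rewrite -(prednK j_gt0) ltnS /durfee; apply/bigmax_leqP_seq => i.
rewrite mem_index_iota ltnS => /andP[i_gt0 le_i] part_i.
rewrite -ltnS prednK // ltnNge; apply: contraL part_i => le_ji; rewrite -ltnNge.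
apply: leq_ltn_trans (leq_trans lt_j le_ji); rewrite /part.
apply: (sorted_leq_nth geq_trans leqnn) => //; rewrite ?inE; lia.
Qed.

(** The new first rank is (n + 1) - (m + 1). Inside the Durfee square of [mu] the hook lengthens
    each row and column by one, which cancels in the rank. *)
Lemma ranks_ge_add_hook b m n mu : sorted geq mu -> size mu <= m ->
    all (fun x => x <= n) mu ->
  ranks_ge b (add_hook m n mu) = (b <= n%:Z - m%:Z)%R && ranks_ge b mu.
Proof.
move=> mu_sorted le_m mu_le; rewrite /ranks_ge durfee_add_hook //=; congr andb.
  by rewrite /rank conj_part_add_hook1 /part /=; congr (_ <= _)%R; lia.
rewrite -[2]/(1 + 1) iotaDl all_map; apply: eq_in_all => i.
rewrite mem_iota add1n ltnS => i_bnd /=; rewrite add1n.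
have part_i := leq_durfee mu_sorted i_bnd; case/andP: i_bnd => i_gt0 _.
have lt_i : i.-1 < size mu.
  rewrite ltnNge; apply: contraL part_i => ?.
  by rewrite /part nth_default // -ltnNge.
have le_in : i <= n by apply: leq_trans part_i (allP mu_le _ (mem_nth _ lt_i)).
rewrite /rank conj_part_add_hook ?i_gt0 //.
have -> : part (add_hook m n mu) i.+1 = (part mu i).+1.
  by rewrite /part -{1}(prednK i_gt0) /= nth_mkseq // (leq_trans lt_i).
by congr (_ <= _)%R; lia.
Qed.

Lemma is_partition_add_hook m n mu :
    sorted geq mu -> all (fun x => x <= n) mu ->
  is_partition (add_hook m n mu).
Proof.
move=> mu_sorted mu_le; apply/andP; split; last first.
  by apply/allP => x; rewrite inE => /predU1P[-> //|/mapP[i _ ->]].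
apply/(sortedP 0) => -[|i] /=; rewrite size_mkseq !ltnS => lt_i.
  rewrite nth_mkseq // ltnS.
  case: (ltnP 0 (size mu)) => [?|?]; last by rewrite nth_default.
  exact: (allP mu_le _ (mem_nth _ _)).
rewrite !nth_mkseq ?(ltnW lt_i) //= ltnS.
case: (ltnP i.+1 (size mu)) => [lt_i1|?]; last by rewrite nth_default.
exact: (sortedP 0 mu_sorted).
Qed.

Lemma size_add_hook m n mu : size (add_hook m n mu) = m.+1.
Proof. by rewrite /= size_mkseq. Qed.

Lemma add_hook_le m n mu : all (fun x => x <= n) mu ->
  all (fun x => x <= n.+1) (add_hook m n mu).
Proof.
move=> mu_le; apply/allP => x; rewrite inE => /predU1P[-> //|/mapP[i _ ->]].
rewrite ltnS; case: (ltnP i (size mu)) => [?|?]; last by rewrite nth_default.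
exact: (allP mu_le _ (mem_nth _ _)).
Qed.

Lemma add_hookK m n mu : all (fun x => 0 < x) mu -> size mu <= m ->
  remove_hook (add_hook m n mu) = mu.
Proof.
move=> mu_gt0 le_m; rewrite /remove_hook /= mkseq_nth_cat // filter_cat.
rewrite [X in _ ++ X](_ : _ = [::]) ?cats0; last first.
  by elim: (m - _).
elim: mu mu_gt0 {le_m} => //= x mu IHmu /andP[x_gt0 mu_gt0].
by rewrite ltnS x_gt0 /= IHmu.
Qed.

Lemma remove_hookK m n la :
    is_partition la -> size la = m.+1 -> head 0 la = n.+1 ->
  add_hook m n (remove_hook la) = la.
Proof.
case: la => [//|x la] /andP[/= la_path /andP[_ la_gt0]] [<-] ->.
rewrite /add_hook /remove_hook /=; congr (_ :: _).
have {la_path} la_sorted := path_sorted la_path.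
have le_m : size [seq y.-1 | y <- la & 1 < y] <= size la.
  by rewrite size_map size_filter count_size.
rewrite mkseq_nth_cat // {le_m}.
elim: la la_gt0 la_sorted => //= y la IHla /andP[y_gt0 la_gt0] la_path.
have IH := IHla la_gt0 (path_sorted la_path).
case: ifP => [lt_1y|ge_1y] /=; first by rewrite prednK // subSS IH.
have y1 : y = 1 by lia.
(* Only 1s can follow a part equal to 1, so the filter cuts off a tail, which the padding in
   [add_hook] restores. *)
have la1 : all (pred1 1) la.
  have /allP le_y := order_path_min geq_trans la_path.
  apply/allP => z z_la /=; have := le_y z z_la; have := allP la_gt0 z z_la.
  by rewrite /= y1; lia.
have f0 : [seq z <- la | 1 < z] = [::].
  rewrite -(filter_pred0 la); apply: eq_in_filter => z /(allP la1) /eqP -> //.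
by rewrite f0 /= y1; congr (_ :: _); apply/esym/all_pred1P.
Qed.

Lemma in_R_remove_hook m n b la : in_R m.+1 n.+1 b la -> size la = m.+1 ->
  head 0 la = n.+1 -> in_R m n b (remove_hook la) && (b <= n%:Z - m%:Z)%R.
Proof.
move=> /and4P[la_part le_m la_le la_ranks] size_la head_la.
have laK := remove_hookK la_part size_la head_la.
have sz : size (remove_hook la) <= m.
  rewrite size_map (leq_trans (size_subseq (filter_subseq _ _))) //.
  by rewrite size_behead size_la.
have le_n : all (fun x => x <= n) (remove_hook la).
  apply/allP => x /mapP[y]; rewrite mem_filter => /andP[_ /mem_behead y_la] ->.
  by have := allP la_le y y_la; lia.
have sorted_mu : sorted geq (remove_hook la).
  rewrite sorted_map; apply: (sub_sorted _ (sorted_filter geq_trans _ _)).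
    by move=> x y /=; rewrite /relpre /=; lia.
  by case/andP: la_part => + _; case: (la) => //= x s /path_sorted.
have mu_gt0 : all (fun x => 0 < x) (remove_hook la).
  by apply/allP => x /mapP[y]; rewrite mem_filter => /andP[lt_1y _] ->; lia.
move: la_ranks; rewrite -{1}laK ranks_ge_add_hook // => /andP[le_b mu_ranks].
by rewrite /in_R /is_partition sorted_mu mu_gt0 sz le_n mu_ranks.
Qed.

Lemma in_R_add_hook m n b mu : in_R m n b mu -> (b <= n%:Z - m%:Z)%R ->
  in_R m.+1 n.+1 b (add_hook m n mu).
Proof.
move=> /and4P[/andP[mu_sorted mu_gt0] le_m mu_le mu_ranks] le_b.
rewrite /in_R is_partition_add_hook // size_add_hook leqnn add_hook_le //=.
by rewrite ranks_ge_add_hook // le_b.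
Qed.

(** The first part of a partition bounds all others, so lying in the large box but in neither subbox
    fixes both the size and the first part. *)
Lemma in_R_corner m n b la :
  (in_R m.+1 n.+1 b la && (size la == m.+1) && (head 0 la == n.+1)) =
  in_R m.+1 n.+1 b la && ~~ (in_R m n.+1 b la || in_R m.+1 n b la).
Proof.
rewrite /in_R; case la_part: (is_partition la) => //=.
case: (ranks_ge b la); last by rewrite !andbF.
rewrite !andbT; case: la la_part => [|x la] //= /andP[/= la_path /andP[x_gt0 _]].
have /allP le_x := order_path_min geq_trans la_path.
have all_le k : x <= k -> all (fun y => y <= k) la.
  by move=> le_xk; apply/allP => y /le_x /leq_trans; apply.
case: (leqP x n.+1) => [le_xn|]; last by rewrite !andbF.
rewrite all_le //; case: (leqP x n) => [le_x'|lt_nx].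
  by rewrite all_le // (_ : x == n.+1 = false); [lia|apply/eqP; lia].
by rewrite (_ : x == n.+1) /=; [lia|apply/eqP; lia].
Qed.

(** * Boxes and the generating function by rank *)

Definition box (m n : nat) : seq (seq nat) :=
  [seq bseq_nat s | s <- enum {: {bseq m of 'I_n.+1}}].

Lemma box_uniq m n : uniq (box m n).
Proof.
rewrite map_inj_uniq ?enum_uniq // => s1 s2 /inj_map eq_s.
by apply: val_inj; apply: eq_s; apply: val_inj.
Qed.

Lemma mem_box m n la :
  (la \in box m n) = (size la <= m) && all (fun x => x <= n) la.
Proof.
apply/mapP/andP => [[s _ ->]|[le_m la_le]].
  rewrite size_map size_bseq; split=> //.
  by apply/allP => _ /mapP[x _ ->]; rewrite -ltnS.
have le_m' : size (map (@inord n) la) <= m by rewrite size_map.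
exists (Bseq le_m'); first by rewrite mem_enum.
rewrite /bseq_nat /= -map_comp -[LHS]map_id; apply/eq_in_map => x x_la /=.
by rewrite inordK // ltnS (allP la_le).
Qed.

Lemma in_R_box m n b la M N :
  m <= M -> n <= N -> in_R m n b la -> la \in box M N.
Proof.
move=> le_mM le_nN /and4P[_ le_m la_le _]; rewrite mem_box (leq_trans le_m) //=.
by apply: sub_all la_le => x /leq_trans; apply.
Qed.

Lemma in_R_mono m n b la M N :
  m <= M -> n <= N -> in_R m n b la -> in_R M N b la.
Proof.
move=> le_mM le_nN la_R; have := in_R_box le_mM le_nN la_R.
by case/and4P: la_R; rewrite mem_box /in_R => -> _ _ -> /andP[-> ->].
Qed.

Lemma in_R_meet m n b la M N :
  in_R m N b la && in_R M n b la -> in_R m n b la.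
Proof. by case/andP=> /and4P[? ? _ ?] /and4P[_ _ ? _]; apply/and4P. Qed.

Local Close Scope nat_scope.

Section RankGeneratingFunction.

Variables (K : fieldType) (q t : K) (b : int).

Let weight (la : seq nat) : K := t ^+ dr la * q ^+ sumn la.

Definition rank_gf (m n : nat) : K :=
  \sum_(la <- box m n | in_R m n b la) weight la.

(** Puts the sums for all subboxes over one index list, as inclusion-exclusion requires. *)
Lemma rank_gf_box m n M N : (m <= M)%N -> (n <= N)%N ->
  rank_gf m n = \sum_(la <- box M N | in_R m n b la) weight la.
Proof.
move=> le_mM le_nN; rewrite /rank_gf -[LHS]big_filter -[RHS]big_filter.
apply/perm_big/uniq_perm; rewrite ?filter_uniq ?box_uniq // => la.
rewrite !mem_filter; case la_R: (in_R m n b la) => //=.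
by rewrite (in_R_box le_mM le_nN la_R) (in_R_box _ _ la_R).
Qed.

Lemma rank_gf_nil m n : (m == 0)%N || (n == 0)%N -> rank_gf m n = 1.
Proof.
move=> mn0; have R_nil la : in_R m n b la = (la == [::]).
  apply/idP/eqP => [/and4P[/andP[_ la_gt0] le_m la_le _]|->]; last first.
    by rewrite /in_R /is_partition /ranks_ge /durfee big_geq.
  case: la le_m la_le la_gt0 => //= x la; case/orP: mn0 => /eqP -> //.
  by rewrite leqn0 => _ /andP[/eqP ->].
rewrite /rank_gf (eq_bigl _ _ R_nil) -big_filter.
rewrite (perm_big [:: [::]]) ?big_seq1; last first.
  apply: uniq_perm; rewrite ?filter_uniq ?box_uniq // => la.
  by rewrite mem_filter inE mem_box; case: eqP => // ->.
by rewrite /weight /dr big_geq //= !expr0 mulr1.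
Qed.

Lemma corner_sum m n :
  \sum_(la <- box m.+1 n.+1 |
        in_R m.+1 n.+1 b la && ~~ (in_R m n.+1 b la || in_R m.+1 n b la)) weight la
  = if b <= n%:Z - m%:Z
    then t ^+ (0 < n)%N * q ^+ (m + n).+1 * rank_gf m n else 0.
Proof.
under eq_bigl do rewrite -in_R_corner.
case: ifP => [le_b|gt_b]; last first.
  rewrite big_pred0 // => la; apply/negP.
  move=> /andP[/andP[la_R /eqP size_la] /eqP head_la].
  by have := in_R_remove_hook la_R size_la head_la; rewrite gt_b andbF.
rewrite mulr_sumr -big_filter -[RHS]big_filter.
(* Reindexing along [add_hook], which is injective here because [remove_hook] undoes it. *)
rewrite (perm_big [seq add_hook m n mu | mu <- box m n & in_R m n b mu]).
  rewrite big_map !big_filter; apply: eq_bigr => mu /and4P[_ le_m mu_le _].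
  by rewrite /weight dr_add_hook // sumn_add_hook // !exprD; ring.
apply: uniq_perm; rewrite ?filter_uniq ?box_uniq ?map_inj_in_uniq //.
- by rewrite filter_uniq ?box_uniq.
- move=> mu nu; rewrite !mem_filter => /andP[/and4P[/andP[_ ?] ? _ _] _].
  move=> /andP[/and4P[/andP[_ ?] ? _ _] _] /(congr1 remove_hook).
  by rewrite !add_hookK.
move=> la; rewrite mem_filter; apply/andP/mapP.
  move=> [/andP[/andP[la_R /eqP size_la] /eqP head_la] _].
  have /andP[mu_R _] := in_R_remove_hook la_R size_la head_la.
  exists (remove_hook la); first by rewrite mem_filter mu_R (in_R_box _ _ mu_R).
  by case/and4P: la_R => la_part _ _ _; rewrite remove_hookK.
case=> mu; rewrite mem_filter => /andP[mu_R _] ->.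
have la_R := in_R_add_hook mu_R le_b.
by rewrite la_R (in_R_box _ _ la_R) // size_add_hook /= !eqxx.
Qed.

Lemma rank_gf_rec m n :
  rank_gf m.+1 n.+1 = rank_gf m n.+1 + rank_gf m.+1 n - rank_gf m n +
    (if b <= n%:Z - m%:Z
     then t ^+ (0 < n)%N * q ^+ (m + n).+1 * rank_gf m n else 0).
Proof.
rewrite -corner_sum.
rewrite (@rank_gf_box m n.+1 m.+1 n.+1) // (@rank_gf_box m.+1 n m.+1 n.+1) //.
rewrite (@rank_gf_box m n m.+1 n.+1) // /rank_gf.
rewrite !(big_mkcond (fun la => in_R _ _ _ la)) [X in _ + X]big_mkcond /=.
rewrite -big_split -sumrB -big_split; apply: eq_bigr => la _ /=.
(* The two subboxes meet in the m x n box; inclusion-exclusion is then checked for each [la]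
   separately. *)
have -> : in_R m n b la = in_R m n.+1 b la && in_R m.+1 n b la.
  apply/idP/idP => [la_R|]; last exact: in_R_meet.
  by rewrite !(in_R_mono _ _ la_R).
case Rm: (in_R m n.+1 b la).
  rewrite (in_R_mono (leqnSn m) (leqnn n.+1) Rm).
  by case: (in_R m.+1 n b la) => /=; ring.
case Rn: (in_R m.+1 n b la); last by rewrite andbT /=; ring.
by rewrite (in_R_mono (leqnn m.+1) (leqnSn n) Rn) /=; ring.
Qed.

End RankGeneratingFunction.

(** * Specialization to the field Q(q, t) *)

Lemma qvar_neq1 i : (0 < i)%N -> 1 - qvar ^+ i != 0.
Proof.
move=> i_gt0; rewrite /qvar -rmorphXn -(rmorph1 (@tofrac _)).
rewrite -rmorphB tofrac_eq0.
rewrite -rmorphXn -(rmorph1 (@polyC _)) -rmorphB polyC_eq0 subr_eq0.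
apply/eqP => /(congr1 (fun p : {poly int} => p`_0)).
by rewrite coef1 coefXn (ltn_eqF i_gt0).
Qed.

(* The summands on the right vanish for i > m, so the sum over all i >= 0 is
   the common value of its partial sums over i < N for N > m.
   The identity fails for n = 0: with m = 0 the left side is then 1, and the
   right side is 0 because [-1, 0]_q = 0. *)
Theorem theorem1p4 (m n l : nat) (hn : (0 < n)%N) (hmnl : (m <= n + l)%N)
    (N : nat) (hN : (m < N)%N) :
  \sum_(s : {bseq m of 'I_n.+1} | in_R m n (1 - l%:Z) (bseq_nat s))
      tvar ^+ dr (bseq_nat s) * qvar ^+ sumn (bseq_nat s)
  = \sum_(0 <= i < N) tvar ^+ i * qvar ^+ (i * i.+1) *
      (qbinom qvar (n%:Z - 1) i%:Z * qbinom qvar (m%:Z + 1) (i%:Z + 1)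
       - qvar ^+ l.+1 * qbinom qvar (n%:Z + l%:Z) i%:Z
         * qbinom qvar (m%:Z - l%:Z) (i%:Z + 1)).
Proof.
have -> : \sum_(s : {bseq m of 'I_n.+1} | in_R m n (1 - l%:Z) (bseq_nat s))
      tvar ^+ dr (bseq_nat s) * qvar ^+ sumn (bseq_nat s) =
    rank_gf qvar tvar (1 - l%:Z) m n.
  by rewrite /rank_gf big_map big_enum_cond.
case: n hn hmnl => // n _ le_m.
rewrite (corner_recurrence_solution
           (t := tvar) (l := l) qvar_neq1 _ _ _ le_m hN).
- rewrite /durfee_sum mulr_sumr -sumrB; apply: eq_bigr => i _.
  have -> : n.+1%:Z - 1 = n%:Z by lia.
  have -> : m%:Z + 1 = m.+1%:Z by lia.
  have -> : i%:Z + 1 = i.+1%:Z by lia.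
  (* Where the integer [m - l] is negative the truncated one is 0; both binomials then vanish, the
     lower index being positive. *)
  have -> : qbinom qvar (m%:Z - l%:Z) i.+1%:Z = qbinom qvar (m - l)%N%:Z i.+1%:Z.
    have [lt_ml|le_lm] := ltnP m l; last by rewrite subzn.
    have /eqP -> : (m - l == 0)%N by lia.
    rewrite qbinom_small // /qbinom ifF //; lia.
  by rewrite PoszD; ring.
- by move=> k; rewrite rank_gf_nil.
- by move=> k; rewrite rank_gf_nil ?orbT.
move=> j k; rewrite rank_gf_rec.
(* The bound on the first rank k - j of an extremal partition becomes the bracket condition. *)
by have -> : (1 - l%:Z <= k%:Z - j%:Z) = (j < k + l)%N by lia.
Qed.
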